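(* Let $A$ be a ring, $\mathsf{M}=\{\mathsf{M}^p\}_{p\in\mathbb{Z}}$ a bounded filtration of $\mathsf{Mod}\,A$ by localizing subcategories and $\mathrm{E}_{\mathsf{M}}$ the associated Cousin functor. Let $M\in\mathsf{D}^{\mathrm{b}}(\mathsf{Mod}\,A)$ be a complex satisfying $$\mathrm{H}^{p+q}_{\mathsf{M}^p/\mathsf{M}^{p+1}}M=0\quad\text{for all }q\ne0\text{ and all }p.$$ Then there is an isomorphism $M\cong\mathrm{Q}\,\mathrm{E}_{\mathsf{M}}M$ in $\mathsf{D}(\mathsf{Mod}\,A)$.
   Context: $\mathsf{Mod}\,A$ is the category of left $A$-modules; $\mathsf{C}(\mathsf{Mod}\,A)$ and $\mathsf{D}(\mathsf{Mod}\,A)$ are the category of complexes and the derived category; $\mathrm{Q}:\mathsf{C}(\mathsf{Mod}\,A)\to\mathsf{D}(\mathsf{Mod}\,A)$ is the localization functor. A localizing subcategory of $\mathsf{Mod}\,A$ is a full subcategory closed under subobjects, quotients, extensions and infinite direct sums; $\Gamma_{\mathsf{N}}M=\{m\in M\mid A\cdot m\in\mathsf{N}\}$ for a localizing subcategory $\mathsf{N}$. A bounded filtration by localizing subcategories is a decreasing family $\cdots\supset\mathsf{M}^{p}\supset\mathsf{M}^{p+1}\supset\cdots$ ($p\in\mathbb{Z}$) of localizing subcategories with $\mathsf{M}^{p_0}=\mathsf{Mod}\,A$ and $\mathsf{M}^{p_1}=0$ for some $p_0\le p_1$. For $M\in\mathsf{D}^+(\mathsf{Mod}\,A)$ with injective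 resolution $M\to I$ (bounded below), put $\mathrm{R}\Gamma_{\mathsf{M}^p/\mathsf{M}^{p+1}}M=\Gamma_{\mathsf{M}^p}I/\Gamma_{\mathsf{M}^{p+1}}I$ and $\mathrm{H}^{q}_{\mathsf{M}^p/\mathsf{M}^{p+1}}M=\mathrm{H}^q\mathrm{R}\Gamma_{\mathsf{M}^p/\mathsf{M}^{p+1}}M$. The filtered complex $\{\Gamma_{\mathsf{M}^p}I\}$ gives a convergent spectral sequence $E_1^{p,q}=\mathrm{H}^{p+q}_{\mathsf{M}^p/\mathsf{M}^{p+1}}M\Rightarrow\mathrm{H}^{p+q}M$. The Cousin functor $\mathrm{E}_{\mathsf{M}}:\mathsf{D}^+(\mathsf{Mod}\,A)\to\mathsf{C}^+(\mathsf{Mod}\,A)$ takes $M$ to the row $q=0$ of the $E_1$ page: $(\mathrm{E}_{\mathsf{M}}M)^p=E_1^{p,0}=\mathrm{H}^p_{\mathsf{M}^p/\mathsf{M}^{p+1}}M$ with coboundary operator $d_1^{p,0}$. *)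

(* Defs.v *)
From HB Require Import structures.
From mathcomp Require Import all_boot all_order all_algebra.
From mathcomp Require Import boolp.

Set Implicit Arguments.
Unset Strict Implicit.
Unset Printing Implicit Defensive.

Import GRing.Theory.
Local Open Scope ring_scope.
Local Open Scope quotient_scope.

(* Left A-modules are [lmodType A].  The eqType and choiceType structures that
   this carries cost nothing in classical logic. *)

Definition mk_linear (A : pzRingType) (V W : lmodType A) (f : V -> W)
    (fL : linear f) : {linear V -> W} :=
  HB.pack f (GRing.isLinear.Build A V W _ f fL).

Record submodule (A : pzRingType) (V : lmodType A) := Submodule {
  submodule_mem :> V -> Prop;
  submodule0 : submodule_mem 0;
  submoduleL : forall (a : A) (u v : V),
    submodule_mem u -> submodule_mem v -> submodule_mem (a *: u + v)
}.

Section SubQuotientModules.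
Variables (A : pzRingType) (V : lmodType A).
Implicit Type S : submodule V.

Definition submodule_pred S : {pred V} := fun x => `[< S x >].

Lemma submodule_pred_closed S : submod_closed (submodule_pred S).
Proof.
split; first by apply/asboolP; exact: submodule0.
by move=> a u v /asboolP Su /asboolP Sv; apply/asboolP; exact: submoduleL.
Qed.

HB.instance Definition _ S :=
  GRing.isSubmodClosed.Build A V (submodule_pred S) (submodule_pred_closed S).

Lemma submoduleP S x : reflect (S x) (x \in submodule_pred S).
Proof. exact: asboolP. Qed.

Record submod_of S :=
  Submod_of { submod_val : V; _ : submod_val \in submodule_pred S }.

HB.instance Definition _ S := [isSub for @submod_val S].
HB.instance Definition _ S := [Choice of submod_of S by <:].
HB.instance Definition _ S := [SubChoice_isSubLmodule of submod_of S by <:].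

Definition quotmod S := Quotient.quot (submodule_pred S).

HB.instance Definition _ S := GRing.Zmodule.on (quotmod S).
HB.instance Definition _ S := EqQuotient.on (quotmod S).

Variable S : submodule V.

Definition quotmod_scale (a : A) (x : quotmod S) : quotmod S :=
  \pi_(quotmod S) (a *: repr x).

Lemma quotmodP (x y : V) :
  \pi_(quotmod S) x = \pi_(quotmod S) y <-> S (x - y).
Proof.
split; first by move/eqP; rewrite -Quotient.idealrBE => /submoduleP.
by move/submoduleP; rewrite Quotient.idealrBE => /eqP.
Qed.

Lemma quotmod_scaleE (a : A) (x : V) :
  quotmod_scale a (\pi_(quotmod S) x) = \pi_(quotmod S) (a *: x).
Proof.
apply/quotmodP/submoduleP; rewrite -scalerBr rpredZ //.
by apply/submoduleP/quotmodP; rewrite reprK.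
Qed.

Lemma quotmod_piD (x y : V) :
  \pi_(quotmod S) (x + y) = \pi_(quotmod S) x + \pi_(quotmod S) y.
Proof. exact: (@Quotient.pi_add V (submodule_pred S)). Qed.

Lemma quotmod_scaleA a b v :
  quotmod_scale a (quotmod_scale b v) = quotmod_scale (a * b) v.
Proof. by rewrite -[v]reprK (quotmod_scaleE b) !quotmod_scaleE scalerA. Qed.

Lemma quotmod_scale1 : left_id 1 quotmod_scale.
Proof. by move=> v; rewrite -[v]reprK quotmod_scaleE scale1r. Qed.

Lemma quotmod_scaleDr : right_distributive quotmod_scale +%R.
Proof.
move=> a u v; rewrite -[u]reprK -[v]reprK -quotmod_piD !quotmod_scaleE.
by rewrite scalerDr quotmod_piD.
Qed.

Lemma quotmod_scaleDl v : {morph quotmod_scale^~ v : a b / a + b}.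
Proof.
move=> a b /=; rewrite -[v]reprK !quotmod_scaleE.
by rewrite scalerDl quotmod_piD.
Qed.

HB.instance Definition _ := GRing.Zmodule_isLmodule.Build A (quotmod S)
  quotmod_scaleA quotmod_scale1 quotmod_scaleDr quotmod_scaleDl.

Lemma quotmod_pi_linear : linear (\pi_(quotmod S) : V -> quotmod S).
Proof. by move=> a u v; rewrite quotmod_piD -quotmod_scaleE. Qed.

Lemma quotmod_pi0 (x : V) : \pi_(quotmod S) x = 0 <-> S x.
Proof.
have <- : \pi_(quotmod S) 0 = 0 by apply: (linear0 (mk_linear quotmod_pi_linear)).
by rewrite quotmodP subr0.
Qed.

End SubQuotientModules.


Section InducedMaps.
Variables (A : pzRingType) (V W : lmodType A) (f : {linear V -> W}).

Lemma submod_map_subproof (S : submodule V) (T : submodule W)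
    (fST : forall x, S x -> T (f x)) (x : submod_of S) :
  f (val x) \in submodule_pred T.
Proof. by apply/submoduleP/fST/submoduleP; case: x. Qed.

Definition submod_map_fun (S : submodule V) (T : submodule W)
    (fST : forall x, S x -> T (f x)) (x : submod_of S) : submod_of T :=
  Submod_of (submod_map_subproof fST x).

Lemma submod_map_linear S T fST : linear (@submod_map_fun S T fST).
Proof. by move=> a u v; apply: val_inj; rewrite /= !linearP. Qed.

Definition submod_map S T fST : {linear submod_of S -> submod_of T} :=
  mk_linear (@submod_map_linear S T fST).

Definition quotmod_map_fun (S : submodule V) (T : submodule W)
    (fST : forall x, S x -> T (f x)) (x : quotmod S) : quotmod T :=
  \pi_(quotmod T) (f (repr x)).

Lemma quotmod_map_funE S T fST (x : V) :
  @quotmod_map_fun S T fST (\pi_(quotmod S) x) = \pi_(quotmod T) (f x).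
Proof.
by apply/quotmodP; rewrite -linearB; apply/fST/quotmodP; rewrite reprK.
Qed.

Lemma quotmod_map_linear S T fST : linear (@quotmod_map_fun S T fST).
Proof.
move=> a u v; rewrite -[u]reprK -[v]reprK -quotmod_pi_linear.
by rewrite !quotmod_map_funE linearP quotmod_pi_linear.
Qed.

Definition quotmod_map S T fST : {linear quotmod S -> quotmod T} :=
  mk_linear (@quotmod_map_linear S T fST).

Lemma quotmod_mapE S T fST (x : V) :
  @quotmod_map S T fST (\pi_(quotmod S) x) = \pi_(quotmod T) (f x).
Proof. exact: quotmod_map_funE. Qed.

Lemma kernel_subproof (a : A) (u v : V) :
  f u = 0 -> f v = 0 -> f (a *: u + v) = 0.
Proof. by move=> fu fv; rewrite linearP fu fv scaler0 addr0. Qed.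

Definition kernel : submodule V :=
  @Submodule A V (fun x => f x = 0) (linear0 f) kernel_subproof.

Lemma image0_subproof : exists x, f x = 0.
Proof. by exists 0; rewrite linear0. Qed.

Lemma imageL_subproof (a : A) (u v : W) :
  (exists x, f x = u) -> (exists x, f x = v) -> exists x, f x = a *: u + v.
Proof. by case=> x <- [y <-]; exists (a *: x + y); rewrite linearP. Qed.

Definition image : submodule W :=
  @Submodule A W (fun y => exists x, f x = y)
    image0_subproof imageL_subproof.

End InducedMaps.

Section Restrict.
Variables (A : pzRingType) (V : lmodType A) (S T : submodule V).

Lemma restrict0_subproof : T (val (0 : submod_of S)).
Proof. exact: submodule0. Qed.

Lemma restrictL_subproof (a : A) (u v : submod_of S) :
  T (val u) -> T (val v) -> T (val (a *: u + v)).
Proof. by rewrite linearP; exact: submoduleL. Qed.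

(* The intersection of S and T, as a submodule of S. *)
Definition restrict : submodule (submod_of S) :=
  @Submodule A (submod_of S) (fun x => T (val x))
    restrict0_subproof restrictL_subproof.

End Restrict.

Section CyclicModule.
Variables (A : pzRingType) (V : lmodType A) (m : V).

Lemma cyclic0_subproof : exists a : A, 0 = a *: m.
Proof. by exists 0; rewrite scale0r. Qed.

Lemma cyclicL_subproof (a : A) (u v : V) :
  (exists b, u = b *: m) -> (exists b, v = b *: m) ->
  exists b, a *: u + v = b *: m.
Proof.
by case=> b -> [c ->]; exists (a * b + c); rewrite scalerDl scalerA.
Qed.

Definition cyclic : submodule V :=
  @Submodule A V (fun x => exists a : A, x = a *: m)
    cyclic0_subproof cyclicL_subproof.

End CyclicModule.

Definition zero_module (A : pzRingType) (V : lmodType A) := forall x : V, x = 0.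

Definition injective_module (A : pzRingType) (E : lmodType A) :=
  forall (V W : lmodType A) (i : {linear V -> W}) (g : {linear V -> E}),
    injective i -> exists h : {linear W -> E}, forall x, h (i x) = g x.

Definition surjective (X Y : Type) (f : X -> Y) := forall y, exists x, f x = y.

Definition is_direct_sum (A : pzRingType) (J : Type) (V : J -> lmodType A)
    (S : lmodType A) (iota : forall j, {linear V j -> S}) :=
  forall (W : lmodType A) (g : forall j, {linear V j -> W}),
    exists h : {linear S -> W},
      (forall j x, h (iota j x) = g j x) /\
      (forall h' : {linear S -> W},
         (forall j x, h' (iota j x) = g j x) -> h' =1 h).

Record localizing (A : pzRingType) := Localizing {
  loc_mem :> lmodType A -> Prop;
  loc_sub : forall (V W : lmodType A) (i : {linear V -> W}),
    injective i -> loc_mem W -> loc_mem V;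
  loc_quot : forall (V W : lmodType A) (p : {linear V -> W}),
    surjective p -> loc_mem V -> loc_mem W;
  loc_ext : forall (V' V V'' : lmodType A)
      (i : {linear V' -> V}) (p : {linear V -> V''}),
    injective i -> surjective p ->
    (forall x, p x = 0 <-> exists y, i y = x) ->
    loc_mem V' -> loc_mem V'' -> loc_mem V;
  loc_sum : forall (J : Type) (V : J -> lmodType A) (S : lmodType A)
      (iota : forall j, {linear V j -> S}),
    is_direct_sum iota -> (forall j, loc_mem (V j)) -> loc_mem S
}.

Record bounded_filtration (A : pzRingType) := BoundedFiltration {
  filt :> int -> localizing A;
  filt_decr : forall (p : int) (V : lmodType A), filt (p + 1) V -> filt p V;
  filt_bounded : exists p0 p1 : int, [/\ (p0 <= p1)%R,
    forall V : lmodType A, filt p0 V &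
    forall V : lmodType A, filt p1 V <-> zero_module V]
}.

Section Gamma.
Variables (A : pzRingType) (N : localizing A).

Lemma loc_zero (V : lmodType A) : zero_module V -> N V.
Proof.
move=> V0; have zlin (W : lmodType A) : linear (fun _ : V => 0 : W).
  by move=> a u v; rewrite scaler0 addr0.
apply: (@loc_sum _ N False (fun j => match j with end) V
          (fun j => match j with end)) => [W g|[]].
exists (mk_linear (zlin W)); split=> [[]|h' _ x].
by rewrite (V0 x) !linear0.
Qed.

Section Sum.
Variables (V : lmodType A).

Lemma Gamma0_subproof : N (submod_of (cyclic (0 : V))).
Proof.
apply: loc_zero => -[x xP]; apply: val_inj => /=.
by have /submoduleP[a ->] := xP; rewrite scaler0.
Qed.

Variables (x y : V).

Lemma span2_0 : exists a b : A, 0 = a *: x + b *: y.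
Proof. by exists 0, 0; rewrite !scale0r addr0. Qed.

Lemma span2_L (c : A) (u v : V) :
  (exists a b : A, u = a *: x + b *: y) ->
  (exists a b : A, v = a *: x + b *: y) ->
  exists a b : A, c *: u + v = a *: x + b *: y.
Proof.
move=> [a [b ->]] [a' [b' ->]]; exists (c * a + a'), (c * b + b').
by rewrite scalerDr !scalerDl !scalerA addrACA.
Qed.

Definition span2 : submodule V :=
  @Submodule A V (fun z => exists a b : A, z = a *: x + b *: y)
    span2_0 span2_L.

Lemma loc_span2 : N (submod_of (cyclic x)) -> N (submod_of (cyclic y)) ->
  N (submod_of span2).
Proof.
move=> Nx Ny.
have xS z : cyclic x z -> span2 (@idfun V z).
  by case=> a ->; exists a, 0; rewrite scale0r addr0.
have yS z : cyclic y z -> span2 (@idfun V z).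
  by case=> a ->; exists 0, a; rewrite scale0r add0r.
pose i := submod_map xS; pose j := submod_map yS.
pose p := mk_linear (quotmod_pi_linear (image i)).
apply: (@loc_ext _ N _ _ _ i p) => //.
- by move=> u v /(congr1 val) /= uv; apply: val_inj.
- by move=> w; exists (repr w); rewrite /= reprK.
- by move=> w; exact: quotmod_pi0.
have pj : linear (fun z => p (j z)).
  by move=> a u v; rewrite (linearP j) (linearP p).
apply: (@loc_quot _ N _ _ (mk_linear pj)) Ny => w.
have [a [b wE]] : span2 (val (repr w)) by apply/submoduleP; case: (repr w).
have yb : b *: y \in submodule_pred (cyclic y) by apply/submoduleP; exists b.
have xa : - (a *: x) \in submodule_pred (cyclic x).
  by apply/submoduleP; exists (- a); rewrite scaleNr.
exists (Submod_of yb); rewrite -[w]reprK /=; apply/quotmodP.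
exists (Submod_of xa); apply: val_inj => /=; rewrite wE.
by rewrite opprD addrCA subrr addr0.
Qed.

Lemma GammaL_subproof (a : A) :
  N (submod_of (cyclic x)) -> N (submod_of (cyclic y)) ->
  N (submod_of (cyclic (a *: x + y))).
Proof.
move=> Nx Ny; have := loc_span2 Nx Ny.
have zS z : cyclic (a *: x + y) z -> span2 (@idfun V z).
  by case=> b ->; exists (b * a), b; rewrite scalerDr scalerA.
apply: (@loc_sub _ N _ _ (submod_map zS)).
by move=> u v /(congr1 val) /= uv; apply: val_inj.
Qed.

End Sum.

Definition Gamma (V : lmodType A) : submodule V :=
  @Submodule A V (fun m => N (submod_of (cyclic m)))
    (Gamma0_subproof V) (fun a u v => @GammaL_subproof V u v a).

Lemma Gamma_map (V W : lmodType A) (f : {linear V -> W}) (m : V) :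
  Gamma V m -> Gamma W (f m).
Proof.
have fm z : cyclic m z -> cyclic (f m) (f z).
  by case=> a ->; exists a; rewrite linearZ.
apply: (@loc_quot _ N _ _ (submod_map fm)) => -[w wP].
have /submoduleP[a wE] := wP.
have am : a *: m \in submodule_pred (cyclic m) by apply/submoduleP; exists a.
by exists (Submod_of am); apply: val_inj; rewrite /= linearZ.
Qed.

End Gamma.

(* Cochain complexes indexed by int.  The differential is a family d i j
   indexed by its source and target degrees, zero unless j = i + 1; this avoids
   transporting along equations such as n - 1 + 1 = n. *)
Record complex (A : pzRingType) := Complex {
  cobj :> int -> lmodType A;
  cdiff : forall i j, {linear cobj i -> cobj j};
  cdiff_shape : forall i j x, i + 1 != j -> cdiff i j x = 0;
  cdiffK : forall i j k x, cdiff j k (cdiff i j x) = 0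
}.

Record chain_map (A : pzRingType) (C D : complex A) := ChainMap {
  chain_fun :> forall n, {linear C n -> D n};
  chain_comm : forall i j x,
    chain_fun j (cdiff C i j x) = cdiff D i j (chain_fun i x)
}.

Section ChainMaps.
Variable A : pzRingType.

Lemma idfun_linear (V : lmodType A) : linear (fun x : V => x).
Proof. by []. Qed.

Definition chain_id (C : complex A) : chain_map C C :=
  @ChainMap A C C (fun n => mk_linear (idfun_linear (V := C n)))
    (fun i j x => erefl).

Variables (C D E : complex A) (g : chain_map D E) (f : chain_map C D).

Lemma chain_comp_linear n : linear (fun x => g n (f n x)).
Proof. by move=> a u v; rewrite !linearP. Qed.

Lemma chain_comp_comm i j x :
  g j (f j (cdiff C i j x)) = cdiff E i j (g i (f i x)).
Proof. by rewrite !chain_comm. Qed.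

Definition chain_comp : chain_map C E :=
  @ChainMap A C E (fun n => mk_linear (chain_comp_linear (n := n)))
    chain_comp_comm.

End ChainMaps.

Section Cohomology.
Variable A : pzRingType.

Definition cocycle (C : complex A) (n : int) : submodule (C n) :=
  kernel (cdiff C n (n + 1)).

Definition coboundary (C : complex A) (n : int) :
    submodule (submod_of (cocycle C n)) :=
  restrict (cocycle C n) (image (cdiff C (n - 1) n)).

Definition cohomology (C : complex A) (n : int) : lmodType A :=
  quotmod (coboundary C n).

Variables (C D : complex A) (f : chain_map C D) (n : int).

Lemma cocycle_map x : cocycle C n x -> cocycle D n (f n x).
Proof. by rewrite /= -chain_comm => ->; rewrite linear0. Qed.

Lemma coboundary_map x :
  coboundary C n x -> coboundary D n (submod_map cocycle_map x).
Proof.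
by case=> y yE; exists (f (n - 1) y); rewrite -chain_comm yE.
Qed.

Definition cohomology_map : {linear cohomology C n -> cohomology D n} :=
  quotmod_map coboundary_map.

End Cohomology.

Definition quasi_iso (A : pzRingType) (C D : complex A) (f : chain_map C D) :=
  forall n, bijective (cohomology_map f n).

Definition bounded_below (A : pzRingType) (C : complex A) :=
  exists n0 : int, forall n, (n < n0)%R -> zero_module (C n).

(* M lies in D^b(Mod A). *)
Definition bounded_cohomology (A : pzRingType) (C : complex A) :=
  exists a b : int, forall n, (n < a)%R || (b < n)%R ->
    zero_module (cohomology C n).

Definition injective_resolution (A : pzRingType) (M I : complex A)
    (eta : chain_map M I) :=
  [/\ bounded_below I, forall n, injective_module (I n) & quasi_iso eta].

Section SubQuotientComplexes.
Variables (A : pzRingType) (C : complex A) (S : forall n, submodule (C n)).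
Hypothesis dS : forall i j x, S i x -> S j (cdiff C i j x).

Lemma sub_complex_shape i j (x : submod_of (S i)) :
  i + 1 != j -> submod_map (@dS i j) x = 0.
Proof. by move=> ij; apply: val_inj; rewrite /= cdiff_shape. Qed.

Lemma sub_complexK i j k (x : submod_of (S i)) :
  submod_map (@dS j k) (submod_map (@dS i j) x) = 0.
Proof. by apply: val_inj; rewrite /= cdiffK. Qed.

Definition sub_complex : complex A :=
  @Complex A (fun n => submod_of (S n)) (fun i j => submod_map (@dS i j))
    sub_complex_shape sub_complexK.

Lemma quot_complex_shape i j (x : quotmod (S i)) :
  i + 1 != j -> quotmod_map (@dS i j) x = 0.
Proof.
move=> ij; rewrite -[x]reprK quotmod_mapE cdiff_shape //.
exact/quotmod_pi0/submodule0.
Qed.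

Lemma quot_complexK i j k (x : quotmod (S i)) :
  quotmod_map (@dS j k) (quotmod_map (@dS i j) x) = 0.
Proof.
rewrite -[x]reprK (quotmod_mapE (@dS i j)) (quotmod_mapE (@dS j k)) cdiffK.
exact/quotmod_pi0/submodule0.
Qed.

Definition quot_complex : complex A :=
  @Complex A (fun n => quotmod (S n)) (fun i j => quotmod_map (@dS i j))
    quot_complex_shape quot_complexK.

End SubQuotientComplexes.

Section GammaComplexes.
Variables (A : pzRingType) (N N' : localizing A) (I : complex A).

Definition Gamma_complex : complex A :=
  sub_complex (fun i j => @Gamma_map A N (I i) (I j) (cdiff I i j)).

Lemma Gamma_restrict_map i j (x : Gamma_complex i) :
  restrict (Gamma N (I i)) (Gamma N' (I i)) x ->
  restrict (Gamma N (I j)) (Gamma N' (I j)) (cdiff Gamma_complex i j x).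
Proof. exact: Gamma_map. Qed.

(* For I an injective resolution of M this is RGamma_{N/N'} M. *)
Definition Gamma_quot : complex A := quot_complex Gamma_restrict_map.

End GammaComplexes.

Section Cousin.
Variables (A : pzRingType) (F : bounded_filtration A) (I : complex A).

Definition gr (p : int) : complex A := Gamma_quot (F p) (F (p + 1)) I.

(* E_1^{p,q}, indexed by the total degree n = p + q. *)
Definition E1 (p n : int) : lmodType A := cohomology (gr p) n.

Definition E1_cycle (p n : int) (x : I n) :=
  Gamma (F p) (I n) x /\
  Gamma (F (p + 1)) (I (n + 1)) (cdiff I n (n + 1) x).

(* The class in E_1 of an element of I; the default values of insubd are not
   reached when x satisfies E1_cycle. *)
Definition E1_class (p n : int) (x : I n) : E1 p n :=
  \pi_(quotmod (coboundary (gr p) n))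
    (insubd (0 : submod_of (cocycle (gr p) n))
       (\pi_(quotmod (restrict (Gamma (F p) (I n)) (Gamma (F (p + 1)) (I n))))
          (insubd (0 : submod_of (Gamma (F p) (I n))) x))).

Definition E1_repr (p n : int) (c : E1 p n) : I n :=
  val (repr (val (repr c : submod_of (cocycle (gr p) n))
             : quotmod (restrict (Gamma (F p) (I n))
                                 (Gamma (F (p + 1)) (I n))))).

Section Class.
Variables p n : int.

Let G := Gamma (F p) (I n).
Let G' := Gamma (F (p + 1)) (I n).

Let u0 (x : I n) : submod_of G := insubd 0 x.
Let piG := mk_linear (quotmod_pi_linear (restrict G G')).
Let z0 (x : I n) : submod_of (cocycle (gr p) n) := insubd 0 (piG (u0 x)).
Let piZ := mk_linear (quotmod_pi_linear (coboundary (gr p) n)).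

Lemma E1_u0K x : G x -> val (u0 x) = x.
Proof. by move=> Gx; rewrite /u0 insubdK //; apply/submoduleP. Qed.

Lemma E1_cdiff_pi m (u : submod_of G) :
  cdiff (gr p) n m (piG u) =
  \pi_(quotmod (restrict (Gamma (F p) (I m)) (Gamma (F (p + 1)) (I m))))
    (cdiff (Gamma_complex (F p) I) n m u).
Proof. exact: quotmod_mapE. Qed.

Lemma E1_cocycleP (u : submod_of G) :
  cocycle (gr p) n (piG u) <->
  Gamma (F (p + 1)) (I (n + 1)) (cdiff I n (n + 1) (val u)).
Proof.
change (cdiff (gr p) n (n + 1) (piG u) = 0 <->
  Gamma (F (p + 1)) (I (n + 1)) (cdiff I n (n + 1) (val u))).
by rewrite E1_cdiff_pi quotmod_pi0.
Qed.

Lemma E1_z0K x : E1_cycle p x -> val (z0 x) = piG (u0 x).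
Proof.
case=> Gx dx; rewrite /z0 insubdK //; apply/submoduleP/E1_cocycleP.
by rewrite E1_u0K.
Qed.

Lemma E1_cycleL (a : A) (x y : I n) :
  E1_cycle p x -> E1_cycle p y -> E1_cycle p (a *: x + y).
Proof.
by move=> [x1 x2] [y1 y2]; split; rewrite ?linearP; exact: submoduleL.
Qed.

Lemma E1_classL (a : A) (x y : I n) : E1_cycle p x -> E1_cycle p y ->
  E1_class p (a *: x + y) = a *: E1_class p x + E1_class p y.
Proof.
move=> cx cy; have cxy := E1_cycleL a cx cy.
have uE : u0 (a *: x + y) = a *: u0 x + u0 y.
  apply: val_inj; rewrite linearP /= E1_u0K; last exact: cxy.1.
  by rewrite !E1_u0K; [|exact: cy.1|exact: cx.1].
have zE : z0 (a *: x + y) = a *: z0 x + z0 y.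
  by apply: val_inj; rewrite linearP /= !E1_z0K // uE linearP.
by rewrite -[LHS]/(piZ (z0 (a *: x + y))) zE linearP.
Qed.

Lemma E1_class0P (x : I n) : E1_cycle p x ->
  E1_class p x = 0 <->
  exists y : I (n - 1), Gamma (F p) (I (n - 1)) y /\
    Gamma (F (p + 1)) (I n) (x - cdiff I (n - 1) n y).
Proof.
move=> cx; rewrite /E1_class quotmod_pi0 /coboundary /=.
rewrite -[insubd _ _]/(z0 x) E1_z0K //; split.
  case=> w; rewrite -[w]reprK; set u := repr w => /esym.
  rewrite quotmod_map_funE => /quotmodP /= uE; exists (val u).
  have Gu : Gamma (F p) (I (n - 1)) (val u) by apply/submoduleP; case: (u).
  split; first exact: Gu.
  by move: uE; rewrite E1_u0K //; case: cx.
case=> y [Gy dy]; have Gy' := introT (submoduleP (Gamma (F p) _) y) Gy.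
exists (\pi_(quotmod (restrict (Gamma (F p) (I (n - 1)))
   (Gamma (F (p + 1)) (I (n - 1))))) (Submod_of Gy')).
rewrite quotmod_map_funE.
apply/esym/quotmodP; by rewrite /= E1_u0K //; case: cx.
Qed.

Lemma E1_reprP (c : E1 p n) :
  E1_cycle p (E1_repr c) /\ E1_class p (E1_repr c) = c.
Proof.
rewrite /E1_repr; set z := repr c; set u := repr _.
have Gu : G (val u) by apply/submoduleP; case: (u).
have uE : piG u = val z by rewrite /= reprK.
have cu : E1_cycle p (val u).
  split=> //; apply/E1_cocycleP; rewrite uE.
  by apply/submoduleP; case: (z).
split=> //; rewrite -[LHS]/(piZ (z0 (val u))).
suff -> : z0 (val u) = z by rewrite /= reprK.
apply: val_inj; rewrite E1_z0K // -uE; congr (piG _).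
by apply: val_inj; rewrite E1_u0K.
Qed.

End Class.

Definition cousin_diff_fun (i j : int) (c : E1 i i) : E1 j j :=
  E1_class j (cdiff I i j (E1_repr c)).

Lemma cousin_cycle i j (x : I i) :
  E1_cycle i x -> E1_cycle j (cdiff I i j x).
Proof.
move=> [_ dx]; split; last by rewrite cdiffK; exact: (submodule0 (Gamma _ _)).
have [<-//|ij] := eqVneq (i + 1) j.
by rewrite cdiff_shape //; exact: (submodule0 (Gamma _ _)).
Qed.

Lemma E1_class_0 p n : E1_class p (0 : I n) = 0.
Proof.
have c0 : E1_cycle p (0 : I n).
  by split; rewrite ?linear0; exact: (submodule0 (Gamma _ _)).
apply/(E1_class0P c0); exists 0.
split; first exact: (submodule0 (Gamma _ _)).
by rewrite linear0 subrr; exact: (submodule0 (Gamma _ _)).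
Qed.

Lemma E1_class_cdiff i j (g : I i) :
  Gamma (F (i + 1)) (I i) g -> E1_class j (cdiff I i j g) = 0.
Proof.
have [ij|ij] := eqVneq (i + 1) j; last first.
  by rewrite cdiff_shape // E1_class_0.
have iE : i = j - 1 by rewrite -ij addrK.
rewrite ij; subst i => Gg.
have cg : E1_cycle j (cdiff I (j - 1) j g).
  by split; rewrite ?cdiffK; [exact: Gamma_map|exact: (submodule0 (Gamma _ _))].
apply/(E1_class0P cg); exists g; split=> //.
by rewrite subrr; exact: (submodule0 (Gamma _ _)).
Qed.

Lemma cousin_diff_funE i j (x : I i) : E1_cycle i x ->
  cousin_diff_fun j (E1_class i x) = E1_class j (cdiff I i j x).
Proof.
move=> cx; rewrite /cousin_diff_fun.
have [cr] := E1_reprP (E1_class i x); set r := E1_repr _ => rE.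
have crx : E1_cycle i (-1 *: x + r) by exact: E1_cycleL.
have [y [_]] : exists y : I (i - 1), Gamma (F i) (I (i - 1)) y /\
    Gamma (F (i + 1)) (I i) (-1 *: x + r - cdiff I (i - 1) i y).
  apply/(E1_class0P crx).
  by rewrite E1_classL // rE scaleN1r addNr.
set g := _ - _ => Gg.
have dg : cdiff I i j r = 1 *: cdiff I i j g + cdiff I i j x.
  rewrite /g linearB /= cdiffK subr0 scale1r linearP scaleN1r.
  by rewrite addrAC addNr add0r.
have Gdg : Gamma (F j) (I j) (cdiff I i j g).
  have [<-|ij] := eqVneq (i + 1) j; first exact: Gamma_map.
  by rewrite cdiff_shape //; exact: (submodule0 (Gamma _ _)).
have cdg : E1_cycle j (cdiff I i j g).
  by split=> //; rewrite cdiffK; exact: (submodule0 (Gamma _ _)).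
rewrite dg E1_classL //; last exact: cousin_cycle.
by rewrite E1_class_cdiff // scaler0 add0r.
Qed.

Lemma cousin_diff_linear i j : linear (@cousin_diff_fun i j).
Proof.
move=> a u v; have [cu uE] := E1_reprP u; have [cv vE] := E1_reprP v.
rewrite -{1}uE -{1}vE -E1_classL // cousin_diff_funE; last exact: E1_cycleL.
by rewrite linearP E1_classL //; exact: cousin_cycle.
Qed.

(* d_1 on the row q = 0: the class of x goes to the class of its differential
   (cousin_diff_funE). *)
Definition cousin_diff (i j : int) : {linear E1 i i -> E1 j j} :=
  mk_linear (@cousin_diff_linear i j).

Lemma cousin_diff_shape i j (c : E1 i i) : i + 1 != j -> cousin_diff i j c = 0.
Proof.
by move=> ij; rewrite /= /cousin_diff_fun cdiff_shape // E1_class_0.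
Qed.

Lemma cousin_diffK i j k (c : E1 i i) :
  cousin_diff j k (cousin_diff i j c) = 0.
Proof.
have [cr cE] := E1_reprP c.
change (cousin_diff_fun k (E1_class j (cdiff I i j (E1_repr c))) = 0).
rewrite cousin_diff_funE; last exact: cousin_cycle.
by rewrite cdiffK E1_class_0.
Qed.

Definition cousin : complex A :=
  @Complex A (fun p => E1 p p) cousin_diff cousin_diff_shape cousin_diffK.

End Cousin.

(* D(Mod A) is the localization of C(Mod A) at the quasi-isomorphisms: its
   objects are the complexes, Q being the identity on objects, and its morphisms
   are the formal words in chain maps and inverses of quasi-isomorphisms, modulo
   the congruence Deq. *)
Inductive Dmor (A : pzRingType) : complex A -> complex A -> Type :=
| Dmap (X Y : complex A) (f : chain_map X Y) : Dmor X Y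
| Dinv (X Y : complex A) (s : chain_map X Y) (hs : quasi_iso s) : Dmor Y X
| Dcomp (X Y Z : complex A) (v : Dmor Y Z) (u : Dmor X Y) : Dmor X Z.

Inductive Deq (A : pzRingType) :
    forall X Y : complex A, Dmor X Y -> Dmor X Y -> Prop :=
| Deq_refl X Y (u : Dmor X Y) : Deq u u
| Deq_sym X Y (u v : Dmor X Y) : Deq u v -> Deq v u
| Deq_trans X Y (u v w : Dmor X Y) : Deq u v -> Deq v w -> Deq u w
| Deq_comp X Y Z (v v' : Dmor Y Z) (u u' : Dmor X Y) :
    Deq v v' -> Deq u u' -> Deq (Dcomp v u) (Dcomp v' u')
| Deq_assoc X Y Z T (w : Dmor Z T) (v : Dmor Y Z) (u : Dmor X Y) :
    Deq (Dcomp w (Dcomp v u)) (Dcomp (Dcomp w v) u)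
| Deq_id_l X Y (u : Dmor X Y) : Deq (Dcomp (Dmap (chain_id Y)) u) u
| Deq_id_r X Y (u : Dmor X Y) : Deq (Dcomp u (Dmap (chain_id X))) u
| Deq_ext X Y (f g : chain_map X Y) :
    (forall n, f n =1 g n) -> Deq (Dmap f) (Dmap g)
| Deq_map_comp X Y Z (g : chain_map Y Z) (f : chain_map X Y) :
    Deq (Dcomp (Dmap g) (Dmap f)) (Dmap (chain_comp g f))
| Deq_inv_l X Y (s : chain_map X Y) (hs : quasi_iso s) :
    Deq (Dcomp (Dinv hs) (Dmap s)) (Dmap (chain_id X))
| Deq_inv_r X Y (s : chain_map X Y) (hs : quasi_iso s) :
    Deq (Dcomp (Dmap s) (Dinv hs)) (Dmap (chain_id Y)).

Definition D_isomorphic (A : pzRingType) (X Y : complex A) :=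
  exists (u : Dmor X Y) (v : Dmor Y X),
    Deq (Dcomp v u) (Dmap (chain_id X)) /\
    Deq (Dcomp u v) (Dmap (chain_id Y)).

(* Main.v *)
Require Import Defs.
From mathcomp Require Import all_boot all_order all_algebra.
From mathcomp Require Import boolp zify.

Import GRing.Theory.
Local Open Scope ring_scope.
Local Open Scope quotient_scope.

(** Write [F^p] for the subcomplex [Gamma (F p) I] of [I].  The idea is to join
    [I] to the Cousin complex by a roof, without running the spectral sequence.
    The elements [x] of [F^n I^n] with [dx] in [F^(n+1) I^(n+1)] form a subcomplex
    [Z] of [I]: this is the degree zero step of Deligne's shifted (decalee)
    filtration.  Sending [x] to its class in [E_1^{n,0}] is a chain map from [Z]
    onto the Cousin complex, because [d_1] is induced by [d].  So there are maps
    [M -> I <- Z -> cousin], the first of which is a quasi-isomorphism by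
    hypothesis.

    The vanishing of [E_1] off the row [q = 0] says that in degree [n != p] a
    relative cocycle of [F^p] modulo [F^(p+1)] can be pushed into [F^(p+1)] by
    subtracting a coboundary from [F^p].  Since the filtration is finite, this
    step can be iterated.
    - For [p < n] it goes up from [F^p = I] to [F^n] ([push_up_to_diagonal]).
      Thus each cocycle of [I] is cohomologous to one in [Z], and a cochain of [I]
      whose coboundary lies in [Z] can be corrected to one in [Z].  Hence
      [Z -> I] is a quasi-isomorphism.
    - For [p > n] it goes up from [F^p] to [F^p = 0], so that [F^p] is exact in
      degrees below [p] ([exact_below_diagonal]).  The kernel of [Z -> cousin] is
      [F^(n+1) I^n + d (F^n I^(n-1))] in degree [n].  A cocycle [g + dy] of this
      kernel has [dg = 0], so [g] is a coboundary from [F^(n+1) I^(n-1)]: the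
      kernel is acyclic and [Z -> cousin] is a quasi-isomorphism.  The proof below
      says this with elements, to do without a long exact sequence. *)

Set Implicit Arguments.
Unset Strict Implicit.
Unset Printing Implicit Defensive.

(** * Quasi-isomorphisms and the derived category *)

Section QuasiIso.
Variable A : pzRingType.

Definition cocycle_class (E : complex A) n (z : submod_of (cocycle E n)) :
  cohomology E n := \pi_(quotmod (coboundary E n)) z.

Lemma cocycle_class_surj (E : complex A) n : surjective (@cocycle_class E n).
Proof. by move=> c; exists (repr c); exact: reprK. Qed.

Lemma cocycle_classP (E : complex A) n (z z' : submod_of (cocycle E n)) :
  cocycle_class z = cocycle_class z' <->
  exists w, cdiff E (n - 1) n w = val z - val z'.
Proof. exact: quotmodP. Qed.

Lemma cocycle_class_eq0 (E : complex A) n (z : submod_of (cocycle E n)) :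
  cocycle_class z = 0 <-> exists w, cdiff E (n - 1) n w = val z.
Proof. exact: quotmod_pi0. Qed.

Lemma inj_surj_bijective (X Y : Type) (h : X -> Y) :
  injective h -> surjective h -> bijective h.
Proof.
move=> h_inj /choice[k hk]; exists k => // x.
exact: h_inj (hk (h x)).
Qed.

Variables (C D : complex A) (f : chain_map C D).

Lemma cohomology_mapE n (z : submod_of (cocycle C n)) :
  cohomology_map f n (cocycle_class z) =
  cocycle_class (submod_map (@cocycle_map _ _ _ f n) z).
Proof. exact: quotmod_mapE. Qed.

(** This replaces cohomology classes by cochains, so that the comparison maps can be
    studied by chasing elements of [I]. *)
Lemma quasi_iso_elements :
  (forall n (y : D n), cdiff D n (n + 1) y = 0 ->
     exists x w, cdiff C n (n + 1) x = 0 /\ y = f n x + cdiff D (n - 1) n w) ->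
  (forall n (x : C n) (w : D (n - 1)), cdiff C n (n + 1) x = 0 ->
     f n x = cdiff D (n - 1) n w -> exists v, x = cdiff C (n - 1) n v) ->
  quasi_iso f.
Proof.
move=> f_surj f_inj n; apply: inj_surj_bijective.
  suff ker0 c : cohomology_map f n c = 0 -> c = 0 by exact: raddf_inj.
  have [z <-] := cocycle_class_surj c.
  rewrite cohomology_mapE => /cocycle_class_eq0[w wE].
  have /submoduleP dz := valP z.
  have [v vE] := f_inj n (val z) w dz (esym wE).
  by apply/cocycle_class_eq0; exists v.
move=> c; have [z <-] := cocycle_class_surj c.
have /submoduleP dz := valP z.
have [x [w [dx yE]]] := f_surj n (val z) dz.
have xP : x \in submodule_pred (cocycle C n) by apply/submoduleP.
exists (cocycle_class (Submod_of xP)).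
rewrite cohomology_mapE; apply/cocycle_classP; exists (- w).
by rewrite /= yE linearN opprD addrA subrr add0r.
Qed.

End QuasiIso.

Section DerivedIsomorphisms.
Variable A : pzRingType.

Lemma D_isomorphic_quasi_iso (X Y : complex A) (s : chain_map X Y) :
  quasi_iso s -> D_isomorphic X Y.
Proof.
move=> hs; exists (Dmap s), (Dinv hs).
by split; [exact: Deq_inv_l | exact: Deq_inv_r].
Qed.

Lemma D_isomorphic_sym (X Y : complex A) : D_isomorphic X Y -> D_isomorphic Y X.
Proof. by case=> u [v [vu uv]]; exists v, u. Qed.

Lemma Deq_cancel_middle (X Y W : complex A) (u : Dmor X Y) (v : Dmor Y X)
    (u' : Dmor Y W) (v' : Dmor W Y) :
  Deq (Dcomp v u) (Dmap (chain_id X)) -> Deq (Dcomp v' u') (Dmap (chain_id Y)) ->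
  Deq (Dcomp (Dcomp v v') (Dcomp u' u)) (Dmap (chain_id X)).
Proof.
move=> vu vu'; apply: Deq_trans vu.
apply: Deq_trans (Deq_sym (Deq_assoc _ _ _)) _.
apply: Deq_comp; first exact: Deq_refl.
apply: Deq_trans (Deq_assoc _ _ _) _.
apply: Deq_trans (Deq_id_l u).
by apply: Deq_comp => //; exact: Deq_refl.
Qed.

Lemma D_isomorphic_trans (X Y W : complex A) :
  D_isomorphic X Y -> D_isomorphic Y W -> D_isomorphic X W.
Proof.
move=> [u [v [vu uv]]] [u' [v' [vu' uv']]].
by exists (Dcomp u' u), (Dcomp v v'); split; exact: Deq_cancel_middle.
Qed.

End DerivedIsomorphisms.

(** * The filtration of a complex by torsion subcomplexes *)

Section Filtration.
Variables (A : pzRingType) (F : bounded_filtration A).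

Lemma filt_le (p p' : int) (V : lmodType A) : (p <= p')%R -> F p' V -> F p V.
Proof.
move=> pp'; have -> : p' = p + `|p' - p|%N%:Z by lia.
elim: `|_|%N => [|k IH]; first by rewrite addr0.
by rewrite -addn1 PoszD addrA => /filt_decr.
Qed.

Lemma Gamma_le (p p' : int) (V : lmodType A) (x : V) :
  (p <= p')%R -> Gamma (F p') V x -> Gamma (F p) V x.
Proof. exact: filt_le. Qed.

Lemma Gamma_exhaustive :
  exists p0 : int, forall p (V : lmodType A) (x : V),
    (p <= p0)%R -> Gamma (F p) V x.
Proof.
have [p0 [_ [_ F0 _]]] := filt_bounded F.
by exists p0 => p V x /filt_le; apply; exact: F0.
Qed.

Lemma Gamma_separated :
  exists p1 : int, forall p (V : lmodType A) (x : V),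
    (p1 <= p)%R -> Gamma (F p) V x -> x = 0.
Proof.
have [_ [p1 [_ _ F1]]] := filt_bounded F; exists p1 => p V x pp1 /(Gamma_le pp1).
have xP : x \in submodule_pred (cyclic x).
  by apply/submoduleP; exists 1; rewrite scale1r.
by move=> /F1 /(_ (Submod_of xP)) /(congr1 val).
Qed.

Variable I : complex A.

Lemma Gamma0 p n : Gamma (F p) (I n) 0.
Proof. exact: submodule0. Qed.

Lemma GammaD p n (x y : I n) :
  Gamma (F p) (I n) x -> Gamma (F p) (I n) y -> Gamma (F p) (I n) (x + y).
Proof. by move=> Gx Gy; rewrite -[x]scale1r; exact: submoduleL. Qed.

Lemma GammaN p n (x : I n) : Gamma (F p) (I n) x -> Gamma (F p) (I n) (- x).
Proof.
move=> Gx; rewrite -scaleN1r -[_ *: x]addr0.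
by apply: submoduleL => //; exact: submodule0.
Qed.

Lemma GammaB p n (x y : I n) :
  Gamma (F p) (I n) x -> Gamma (F p) (I n) y -> Gamma (F p) (I n) (x - y).
Proof. by move=> Gx /GammaN; exact: GammaD. Qed.

(** Quantifying over the target degree of the differential avoids transport along
    [n - 1 + 1 = n]. *)
Lemma Gamma_cdiff p n m0 (x : I n) : n + 1 = m0 ->
  Gamma (F p) (I m0) (cdiff I n m0 x) ->
  forall m, Gamma (F p) (I m) (cdiff I n m x).
Proof.
move=> <- dx m; have [<-//|nm] := eqVneq (n + 1) m.
by rewrite cdiff_shape //; exact: Gamma0.
Qed.

Lemma E1_cycleP p n (x : I n) :
  E1_cycle F p x <-> Gamma (F p) (I n) x /\
    forall m, Gamma (F (p + 1)) (I m) (cdiff I n m x).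
Proof. by split=> -[Gx dx]; split=> //; exact: Gamma_cdiff dx. Qed.

Lemma Gamma_E1_cycle p n (x : I n) : Gamma (F (p + 1)) (I n) x -> E1_cycle F p x.
Proof.
move=> Gx; split; last exact: Gamma_map.
by apply: Gamma_le Gx; lia.
Qed.

Lemma cocycle_E1_cycle p n (x : I n) :
  Gamma (F p) (I n) x -> cdiff I n (n + 1) x = 0 -> E1_cycle F p x.
Proof. by move=> Gx dx; split=> //; rewrite dx; exact: submodule0. Qed.

Lemma E1_class_Gamma n (x : I n) :
  Gamma (F (n + 1)) (I n) x -> E1_class F n x = 0.
Proof.
move=> Gx; apply/(E1_class0P (Gamma_E1_cycle Gx)); exists 0.
by rewrite linear0 subr0; split=> //; exact: Gamma0.
Qed.

Lemma E1_classB n (x y : I n) : E1_cycle F n x -> E1_cycle F n y ->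
  E1_class F n (x - y) = E1_class F n x - E1_class F n y.
Proof. by move=> cx cy; rewrite addrC -scaleN1r E1_classL // scaleN1r addrC. Qed.

(** * The two-sided comparison with the Cousin complex *)

Lemma Z0_subproof n : E1_cycle F n (0 : I n).
Proof. by split; rewrite ?linear0; exact: Gamma0. Qed.

Definition Z_submodule n : submodule (I n) :=
  Submodule (Z0_subproof n) (fun a u v => @E1_cycleL _ F I n n a u v).

Definition Z_complex : complex A :=
  @sub_complex A I Z_submodule (fun i j x => @cousin_cycle A F I i j x).

Lemma Z_memP n (z : Z_complex n) : E1_cycle F n (val z).
Proof. by apply/(submoduleP (Z_submodule n)); exact: (valP z). Qed.

Definition Z_of n (x : I n) (xZ : E1_cycle F n x) : Z_complex n :=
  Submod_of (introT (submoduleP (Z_submodule n) x) xZ).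

Definition Z_incl : chain_map Z_complex I :=
  @ChainMap A Z_complex I (fun n => mk_linear (fun a u v => erefl :
    val (a *: u + v : Z_complex n) = a *: val u + val v)) (fun i j x => erefl).

Lemma Z_class_linear n : linear (fun z : Z_complex n => E1_class F n (val z)).
Proof. by move=> a u v; rewrite -E1_classL //; exact: Z_memP. Qed.

Lemma Z_class_comm i j (z : Z_complex i) :
  E1_class F j (val (cdiff Z_complex i j z)) =
  cdiff (cousin F I) i j (E1_class F i (val z)).
Proof. by apply/esym/cousin_diff_funE/Z_memP. Qed.

Definition Z_class : chain_map Z_complex (cousin F I) :=
  @ChainMap A Z_complex (cousin F I) (fun n => mk_linear (@Z_class_linear n))
    Z_class_comm.

(** * Consequences of the vanishing of [E_1] off the row [q = 0] *)

Hypothesis E1_vanish : forall p n : int, n != p -> zero_module (E1 F I p n).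

(** If the class of a relative cocycle of [F^p] modulo [F^(p+1)] vanishes, the
    cocycle is a relative coboundary. *)
Lemma push_up p n (x : I n) : n != p -> E1_cycle F p x ->
  exists y : I (n - 1), Gamma (F p) (I (n - 1)) y /\
    Gamma (F (p + 1)) (I n) (x - cdiff I (n - 1) n y).
Proof. by move=> np cx; apply/(E1_class0P cx); exact: E1_vanish. Qed.

(** Each of the finitely many uses of [push_up] changes [x] by a coboundary, hence
    keeps [dx], which stays deep enough in the filtration for the next use. *)
Lemma push_up_to_diagonal n (x : I n) :
  (forall m, Gamma (F (n + 1)) (I m) (cdiff I n m x)) ->
  exists y : I (n - 1), Gamma (F n) (I n) (x - cdiff I (n - 1) n y).
Proof.
have [p0 F0] := Gamma_exhaustive.
(* [n - |n - p0|] is a depth below both [p0] and [n]; it is [n] minus a natural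
   number, so that the induction on this number ends at depth [n]. *)
have: Gamma (F (n - `|n - p0|%N%:Z)) (I n) x by apply: F0; lia.
elim: `|_|%N x => [|k IH] x Gx dx.
  by exists 0; rewrite linear0 !subr0 in Gx *.
have cx : E1_cycle F (n - k.+1%:Z) x.
  by apply/E1_cycleP; split=> // m; apply: Gamma_le (dx m); lia.
have [|y [_ Gxy]] := push_up _ cx; first lia.
have [||y' Gy'] := IH (x - cdiff I (n - 1) n y).
- by apply: Gamma_le Gxy; lia.
- by move=> m; rewrite linearB cdiffK subr0.
by exists (y + y'); rewrite linearD opprD addrA.
Qed.

(** A cocycle stays one while it is pushed up, and it is never pushed through the
    diagonal; so it ends up at a depth where the filtration is zero. *)
Lemma exact_below_diagonal p n (x : I n) : (n < p)%R ->
  Gamma (F p) (I n) x -> cdiff I n (n + 1) x = 0 ->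
  exists2 y : I (n - 1), Gamma (F p) (I (n - 1)) y & x = cdiff I (n - 1) n y.
Proof.
have [p1 F1] := Gamma_separated.
have [k]: exists k : nat, (p1 <= p + k%:Z)%R by exists `|p1 - p|%N; lia.
elim: k p x => [|k IH] p x p1p np Gx dx.
  exists 0; first exact: Gamma0.
  by rewrite linear0; apply: F1 Gx; lia.
have [|y [Gy Gxy]] := push_up _ (cocycle_E1_cycle Gx dx); first lia.
have [||||y' Gy' xE] := IH (p + 1) (x - cdiff I (n - 1) n y); try lia.
- exact: Gxy.
- by rewrite linearB /= cdiffK subr0.
exists (y + y'); last by rewrite linearD -xE addrC subrK.
by apply: GammaD => //; apply: Gamma_le Gy'; lia.
Qed.

(** Both halves use [push_up_to_diagonal]: on a cocycle [y] of [I], and on a cochain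
    [w] whose coboundary lies in [Z]. *)
Lemma Z_incl_quasi_iso : quasi_iso Z_incl.
Proof.
apply: quasi_iso_elements => [n y dy|n z w dz zE].
  have [|v Gv] := @push_up_to_diagonal n y.
    by apply: (Gamma_cdiff (erefl _)); rewrite dy; exact: Gamma0.
  have dyv : cdiff I n (n + 1) (y - cdiff I (n - 1) n v) = 0.
    by rewrite linearB /= dy cdiffK subr0.
  exists (Z_of (cocycle_E1_cycle Gv dyv)), v; split; first exact: val_inj.
  by rewrite /= subrK.
have dw m : Gamma (F (n - 1 + 1)) (I m) (cdiff I (n - 1) m w).
  by rewrite subrK; apply: (Gamma_cdiff (subrK 1 n)); rewrite -zE; case: (Z_memP z).
have [v Gv] := push_up_to_diagonal dw.
have vZ : E1_cycle F (n - 1) (w - cdiff I (n - 1 - 1) (n - 1) v).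
  by apply/E1_cycleP; split=> // m; rewrite linearB /= cdiffK subr0; exact: dw.
by exists (Z_of vZ); apply: val_inj; rewrite /= linearB /= cdiffK subr0.
Qed.

Lemma Z_class_quasi_iso : quasi_iso Z_class.
Proof.
apply: quasi_iso_elements => [n c dc|n z c dz zE].
  have [cx xE] := E1_reprP c; set x := E1_repr c in cx xE.
  (* Since [c] is a cocycle, [dx] is [dy] plus an element of [F^(n+2)] in degree
     [n + 1], with [y] in [F^(n+1)].  By exactness there, the latter is [dy'] with
     [y'] in [F^(n+2)]; then [x - y - y'] is a cocycle with the class of [x]. *)
  have: E1_class F (n + 1) (cdiff I n (n + 1) x) = 0.
    by rewrite -cousin_diff_funE // xE.
  move/(E1_class0P (cousin_cycle (n + 1) cx)).
  rewrite addrK => -[y [Gy Gdxy]].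
  have [|||y' Gy' yE] := @exact_below_diagonal (n + 1 + 1) (n + 1)
      (cdiff I n (n + 1) x - cdiff I n (n + 1) y); try lia.
  - exact: Gdxy.
  - by rewrite linearB /= !cdiffK subrr.
  rewrite addrK in y' Gy' yE.
  have Gyy' : Gamma (F (n + 1)) (I n) (y + y').
    by apply: GammaD => //; apply: Gamma_le Gy'; lia.
  have dx' : cdiff I n (n + 1) (x - (y + y')) = 0.
    by rewrite linearB linearD /= -yE [_ + (_ - _)]addrC subrK subrr.
  have x'Z : E1_cycle F n (x - (y + y')).
    apply: cocycle_E1_cycle dx'; apply: GammaB; first by case: cx.
    by apply: Gamma_le Gyy'; lia.
  exists (Z_of x'Z), 0; split; first exact: val_inj.
  rewrite linear0 addr0 /= E1_classB //; last exact: Gamma_E1_cycle.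
  by rewrite xE (E1_class_Gamma Gyy') subr0.
(* The class of [z] is that of [dx], so [z - dx - dy] lies in [F^(n+1)] for some
   [y] in [F^n].  Being a cocycle it is [dy'] with [y'] in [F^(n+1)], and [y] and
   [y'] belong to [Z]. *)
have [cx xE] := E1_reprP c; set x := E1_repr c in cx xE.
have cdx : E1_cycle F n (cdiff I (n - 1) n x) by exact: cousin_cycle cx.
have cz := Z_memP z.
have czdx : E1_cycle F n (val z - cdiff I (n - 1) n x).
  by rewrite addrC -scaleN1r; exact: E1_cycleL.
have [y [Gy Gr]] : exists y : I (n - 1), Gamma (F n) (I (n - 1)) y /\
    Gamma (F (n + 1)) (I n)
      (val z - cdiff I (n - 1) n x - cdiff I (n - 1) n y).
  apply/(E1_class0P czdx); rewrite E1_classB // -(cousin_diff_funE n cx) xE.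
  by apply/eqP; rewrite subr_eq0; apply/eqP.
have [||y' Gy' yE] := exact_below_diagonal _ Gr; first lia.
  by rewrite !linearB /= !cdiffK !subr0; exact: (congr1 val dz).
have cy : E1_cycle F (n - 1) (y + y').
  apply: Gamma_E1_cycle; rewrite subrK; apply: GammaD => //.
  by apply: Gamma_le Gy'; lia.
have vZ : E1_cycle F (n - 1) (x + (y + y')).
  by rewrite -[x]scale1r; exact: E1_cycleL.
exists (Z_of vZ); apply: val_inj; rewrite /= !linearD -yE.
by rewrite [cdiff I _ _ y + _]addrC subrK addrC subrK.
Qed.

End Filtration.

Unset Implicit Arguments.

Theorem theorem2p11 (A : pzRingType) (F : bounded_filtration A)
    (M I : complex A) (eta : chain_map M I) :
  bounded_cohomology M ->
  injective_resolution eta ->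
  (forall p q : int, q != 0 ->
     zero_module (cohomology (Gamma_quot (F p) (F (p + 1)) I) (p + q))) ->
  D_isomorphic M (cousin F I).
Proof.
move=> _ [_ _ eta_qi] vanish.
have E1_vanish (p n : int) : n != p -> zero_module (E1 F I p n).
  move=> np; have := vanish p (n - p).
  by rewrite subr_eq0 [p + (n - p)]addrC subrK; apply.
apply: D_isomorphic_trans (D_isomorphic_quasi_iso eta_qi) _.
apply: D_isomorphic_trans (D_isomorphic_quasi_iso (Z_class_quasi_iso E1_vanish)).
exact/D_isomorphic_sym/D_isomorphic_quasi_iso/Z_incl_quasi_iso.
Qed.
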